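(* Let $F$ be a finite field, $n\ge 1$, let $\mathcal{C}\subseteq M_n(F)$ be a similarity class with minimal polynomial $\mu$, let $a\in F$ with $x-a\mid\mu$, put $f_a=\mu/(x-a)$, and let $\varnothing\ne S\subseteq\mathcal{C}$. Then: (1) $\bigcap_{A\in S}\mathcal{B}(A,f_a)=\{0\}\iff\bigcap_{A\in S}V_{\mathcal{B}(A,f_a)}=0$. (2) For every $A\in S$, $V_{\mathcal{B}(A,f_a)}=(\operatorname{Im}f_a(A))^\perp$.
   Context: A similarity class is an orbit of $M_n(F)$ under conjugation by $\mathrm{GL}(n,F)$; $\mu\in F[x]$ is the common minimal polynomial of its elements. In $M_n(F)[x]$ the indeterminate $x$ commutes with all coefficients, $F[x]\subseteq M_n(F)[x]$ via scalar matrices, and for $f=\sum_k B_kx^k$, $f(A)=\sum_k B_kA^k$. For $A\in M_n(F)$ with minimal polynomial $m_A$ and $g\in F[x]$ with $g\mid m_A$, $\mathcal{B}(A,g)=\{f\in M_n(F)[x] : (fg)(A)=0,\ \deg f<\deg m_A-\deg g\}$ (zero polynomial included, $\deg 0=-\infty$). Since $\deg m_A-\deg f_a=1$ for $A\in\mathcal{C}$, all elements of $\mathcal{B}(A,f_a)$ are constants, so $\mathcal{B}(A,f_a)$ is regarded as a subset of $M_n(F)$. For $\varnothing\ne T\subseteq M_n(F)$, the row space $V_T\subseteq F^n$ is the span of all $v\in F^n$ such that $v^T$ is a row of some matrix in $T$. For a subspace $V\subseteq F^n$ (column vectors), $V^\perp=\{x\in F^n : x^Ty=0\ \text{for all } y\in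 V\}$. $\operatorname{Im}B$ is the image of $F^n\to F^n$, $v\mapsto Bv$. *)

(* Defs.v *)
From mathcomp Require Import all_boot all_order all_algebra.

Set Implicit Arguments.
Unset Strict Implicit.
Unset Printing Implicit Defensive.

Import GRing.Theory.
Local Open Scope ring_scope.

Section Defs.

Variables (F : finFieldType) (n' : nat).
Local Notation n := n'.+1.

Definition similarity_class (C : {set 'M[F]_n}) : Prop :=
  exists A : 'M[F]_n, C = [set P *m A *m invmx P | P : 'M[F]_n in unitmx].

(* Evaluation in {poly 'M[F]_n} puts the coefficients on the left:
   f.[A] = \sum_k f`_k * A ^+ k (horner_coef).  The size condition says
   deg f < deg (mxminpoly A) - deg g, with deg 0 = -oo, for g != 0. *)
Definition annB (A : 'M[F]_n) (g : {poly F}) : {pred {poly 'M[F]_n}} :=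
  [pred f : {poly 'M[F]_n} |
    ((f * map_poly scalar_mx g).[A] == 0) &&
    (size f <= (size (mxminpoly A)).-1 - (size g).-1)%N].

(* annB A g seen as a set of matrices, meant for
   deg (mxminpoly A) - deg g = 1; see annB_constE. *)
Definition annB_const (A : 'M[F]_n) (g : {poly F}) : {set 'M[F]_n} :=
  [set B : 'M[F]_n | B%:P \in annB A g].

Lemma annB_constE (A : 'M[F]_n) (a : F) (f : {poly 'M[F]_n}) :
    'X - a%:P %| mxminpoly A ->
  f \in annB A (mxminpoly A %/ ('X - a%:P)) <->
  exists2 B, B \in annB_const A (mxminpoly A %/ ('X - a%:P)) & f = B%:P.
Proof.
move=> dvd_a; split=> [fB|[B + ->]]; last by rewrite inE.
have szf : (size f <= 1)%N.
  have /andP[_ ] := fB; move/leq_trans; apply.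
  rewrite size_divp ?polyXsubC_eq0 // size_XsubC subn1 size_mxminpoly.
  by have := mxminpoly_nonconstant A; case: (degree_mxminpoly A) => //= d _; rewrite subSnn.
by exists f`_0; rewrite ?inE -?size1_polyC //; apply: size1_polyC.
Qed.

Definition rows (T : {set 'M[F]_n}) : {set 'cV[F]_n} :=
  [set v : 'cV[F]_n | [exists B in T, exists i, v^T == row i B]].

Definition row_space (T : {set 'M[F]_n}) : {vspace 'cV[F]_n} :=
  <<enum (rows T)>>%VS.

Definition perp (V : {vspace 'cV[F]_n}) : {set 'cV[F]_n} :=
  [set x : 'cV[F]_n | [forall y in V, x^T *m y == 0]].

(* perp V is already a subspace, so the span only changes its type; see
   memv_perpv. *)
Definition perpv (V : {vspace 'cV[F]_n}) : {vspace 'cV[F]_n} :=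
  <<enum (perp V)>>%VS.

Lemma memv_perpv (V : {vspace 'cV[F]_n}) (x : 'cV[F]_n) :
  x \in perpv V <-> forall y, y \in V -> x^T *m y = 0.
Proof.
split=> [xV y yV|xV]; last first.
  by apply: memv_span; rewrite mem_enum inE; apply/forall_inP => y /xV /eqP.
have {xV} : x \in <<in_tuple (enum (perp V))>>%VS by [].
move/coord_span ->.
rewrite linear_sum mulmx_suml big1 // => i _.
rewrite linearZ -scalemxAl.
have : (in_tuple (enum (perp V)))`_i \in enum (perp V) by apply: mem_nth.
by rewrite mem_enum inE => /forall_inP /(_ y yV) /eqP ->; rewrite scaler0.
Qed.

Definition im_mx (B : 'M[F]_n) : {vspace 'cV[F]_n} :=
  limg (linfun (mulmx B : 'cV[F]_n -> 'cV[F]_n)).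

End Defs.

(* Main.v *)
(** With [M := fa(A)], the constants in [B(A, fa)] are the matrices [B] with
    [B M = 0], a condition on each row of [B] separately.  Hence the rows that
    occur are exactly the [v^T] with [v^T M = 0], i.e. the elements of
    [(Im M)^\perp], and every such [v^T] may be repeated in all rows of [B]. *)
Require Import Defs.
From mathcomp Require Import all_boot all_order all_algebra.

Import GRing.Theory.
Local Open Scope ring_scope.

Lemma mem_annB_const (F : finFieldType) (n' : nat) (A B : 'M[F]_n'.+1) (a : F) :
    'X - a%:P %| mxminpoly A ->
  let fa := mxminpoly A %/ ('X - a%:P) in
  (B \in annB_const A fa) = (B *m horner_mx A fa == 0).
Proof.
move=> dvd_a fa; rewrite !inE hornerCM.
(* The degree bound is 1, which every constant meets, so only the vanishing condition remains. *)
suff -> : ((size (mxminpoly A)).-1 - (size fa).-1 = 1)%N.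
  by rewrite size_polyC leq_b1 andbT.
rewrite size_divp ?polyXsubC_eq0 // size_XsubC subn1 size_mxminpoly.
(* With [d] the degree of the minimal polynomial, the goal amounts to [d - d.-1 = 1] in truncated
   subtraction, so [d > 0] is essential. *)
have := mxminpoly_nonconstant A.
by case: (degree_mxminpoly A) => //= d _; rewrite subSnn.
Qed.

Lemma mem_perpv_im (F : finFieldType) (n' : nat) (M : 'M[F]_n'.+1) (v : 'cV[F]_n'.+1) :
  (v \in perpv (im_mx M)) = (v^T *m M == 0).
Proof.
apply/idP/eqP => [/memv_perpv vM|vM].
  apply/matrixP => i k; rewrite ord1 [RHS]mxE.
  (* The image of the [k]-th unit vector is column [k] of [M]; orthogonality to it is the vanishing
     of entry [k] of [v^T *m M]. *)
  have /vM : linfun (mulmx M : 'cV[F]_n'.+1 -> 'cV[F]_n'.+1) (delta_mx k 0)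
      \in im_mx M by rewrite memv_img ?memvf.
  by rewrite lfunE /= mulmxA -colE => /matrixP/(_ 0 0); rewrite [LHS]mxE [RHS]mxE.
apply/memv_perpv => y /memv_imgP[w _ ->].
by rewrite lfunE /= mulmxA vM mul0mx.
Qed.

(** Membership of [v] is by definition inclusion of the line spanned by [v]. *)
Lemma memv_bigcapP (K : fieldType) (vT : vectType K) (I : finType) (P : pred I)
    (Us : I -> {vspace vT}) (v : vT) :
  reflect (forall i, P i -> v \in Us i) (v \in (\bigcap_(i | P i) Us i)%VS).
Proof. exact: subv_bigcapP. Qed.

Section OneMatrix.

Variables (F : finFieldType) (n' : nat) (A : 'M[F]_n'.+1) (a : F).
Hypothesis dvd_a : 'X - a%:P %| mxminpoly A.
Let fa := mxminpoly A %/ ('X - a%:P).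

Lemma row_space_annB_const :
  row_space (annB_const A fa) = perpv (im_mx (horner_mx A fa)).
Proof.
apply/eqP; rewrite eqEsubv; apply/andP; split.
  apply/span_subvP => v; rewrite mem_enum inE mem_perpv_im.
  case/exists_inP => B; rewrite mem_annB_const // => /eqP BM.
  by case/existsP => i /eqP ->; rewrite -row_mul BM row0.
apply/subvP => v; rewrite mem_perpv_im => /eqP vM.
apply: memv_span; rewrite mem_enum inE; apply/exists_inP.
exists (\matrix_i v^T); last by apply/existsP; exists 0; rewrite rowK.
rewrite mem_annB_const //; apply/eqP/row_matrixP => i.
by rewrite row_mul rowK vM row0.
Qed.

(** The test matrix depends on [v] alone and not on [A], so the criterion passes to intersections
    over several [A]. *)
Lemma mem_row_space_annB_const (v : 'cV[F]_n'.+1) :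
  (v \in row_space (annB_const A fa)) = (\matrix_i v^T \in annB_const A fa).
Proof.
rewrite row_space_annB_const mem_perpv_im mem_annB_const //.
apply/eqP/eqP => [vM|/row_matrixP/(_ 0)]; last by rewrite row_mul rowK row0.
by apply/row_matrixP => i; rewrite row_mul rowK vM row0.
Qed.

Lemma tr_row_in_row_space (B : 'M[F]_n'.+1) (i : 'I_n'.+1) :
  B \in annB_const A fa -> (row i B)^T \in row_space (annB_const A fa).
Proof.
rewrite mem_annB_const // row_space_annB_const mem_perpv_im trmxK => /eqP BM.
by rewrite -row_mul BM row0.
Qed.

End OneMatrix.

Theorem lemma4p2 (F : finFieldType) (n' : nat) (C : {set 'M[F]_n'.+1})
    (mu : {poly F}) (a : F) (S : {set 'M[F]_n'.+1})
    (hC : similarity_class C)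
    (hmu : forall A, A \in C -> mxminpoly A = mu)
    (ha : 'X - a%:P %| mu)
    (hS0 : S != set0) (hSC : S \subset C) :
  let fa : {poly F} := mu %/ ('X - a%:P) in
  ((\bigcap_(A in S) annB_const A fa)%SET = [set 0 : 'M[F]_n'.+1] <->
   (\bigcap_(A in S) row_space (annB_const A fa))%VS = 0%VS)
  /\
  (forall A, A \in S ->
     row_space (annB_const A fa) = perpv (im_mx (horner_mx A fa))).
Proof.
move=> fa.
have muS A : A \in S -> mxminpoly A = mu by move/(subsetP hSC)/hmu.
have dvdS A : A \in S -> 'X - a%:P %| mxminpoly A by move/muS->.
(* All of [S] shares [mu], so the one polynomial [fa] is the cofactor for each [A] and the results
   on a single matrix apply. *)
have faS A : A \in S -> fa = mxminpoly A %/ ('X - a%:P) by move/muS->.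
split; last first.
  by move=> A AS; rewrite (faS A AS) row_space_annB_const ?dvdS.
split=> [capB|capV].
  apply/eqP; rewrite -subv0; apply/subvP => v /memv_bigcapP vS.
  have : \matrix_i v^T \in (\bigcap_(A in S) annB_const A fa)%SET.
    apply/bigcapP => A AS; have := vS A AS.
    by rewrite (faS A AS) mem_row_space_annB_const ?dvdS.
  (* Row 0 exists since the size is [n'.+1], and it equals [v^T]. *)
  rewrite capB inE => /eqP/row_matrixP/(_ 0); rewrite rowK row0 => v0.
  by rewrite memv0 -[v]trmxK v0 trmx0.
apply/setP => B; rewrite inE; apply/bigcapP/eqP => [BS|-> A AS].
  (* Each row of a common [B] lies, transposed, in every row space, hence in their zero
     intersection. *)
  apply/row_matrixP => i; rewrite row0; apply: trmx_inj; rewrite trmx0.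
  apply/eqP; rewrite -memv0 -capV; apply/memv_bigcapP => A AS.
  have := BS A AS; rewrite (faS A AS); apply: tr_row_in_row_space.
  exact: dvdS.
by rewrite (faS A AS) mem_annB_const ?dvdS ?mul0mx.
Qed.
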